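(* Let $B$ be a Banach SSD space (Simons space), $A\subseteq B$ a maximally $q$-positive set and $E\in\mathbb{E}_c(A)$. Then $$E\in\mathbb{E}_{ca}(A)\Leftrightarrow\Lambda_E^{@}\leq\Lambda_E.$$
   Context: A symmetrically self-dual space (SSD space) is a pair $(B,\lfloor\cdot,\cdot\rfloor)$ where $B$ is a nonzero real vector space and $\lfloor\cdot,\cdot\rfloor:B\times B\to\mathbb{R}$ is a symmetric bilinear form. Put $q:B\to\mathbb{R}$, $q(b)=\frac12\lfloor b,b\rfloor$. $B$ is a Banach SSD space (Simons space) if it is an SSD space with a norm $\|\cdot\|$ making it a Banach space with norm-dual $B^*$, such that $\frac12\|\cdot\|^2+q\geq 0$ on $B$ and there exists a linear continuous map $\iota:B\to B^*$ with $\langle b,\iota(c)\rangle=\lfloor b,c\rfloor$ for all $b,c\in B$. A set $A\subseteq B$ is $q$-positive if $A\neq\emptyset$ and $q(b-c)\geq 0$ for all $b,c\in A$; it is maximally $q$-positive if it is $q$-positive and maximal with respect to inclusion among the $q$-positive subsets of $B$. $\mathbb{R}_+=[0,+\infty)$, $\overline{\mathbb{R}}=\mathbb{R}\cup\{\pm\infty\}$. The graph of $E:\mathbb{R}_+\rightrightarrows B$ is $G(E)=\{(\varepsilon,b)\in\mathbb{R}_+\times B: b\in E(\varepsilon)\}$; $E$ is closed if $G(E)$ is closed (norm topology). A multifunction $E:\mathbb{R}_+\rightrightarrows B$ satisfies the transportation formula if for all $\varepsilon_1,\varepsilon_2\geq 0$, $b^1\in E(\varepsilon_1)$, $b^2\in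 E(\varepsilon_2)$ and all $\alpha_1,\alpha_2\geq 0$ with $\alpha_1+\alpha_2=1$ one has $\varepsilon:=\alpha_1\varepsilon_1+\alpha_2\varepsilon_2+\alpha_1\alpha_2 q(b^1-b^2)\geq 0$ and $\alpha_1b^1+\alpha_2b^2\in E(\varepsilon)$. $\mathbb{E}(A)$ is the family of multifunctions $E:\mathbb{R}_+\rightrightarrows B$ such that: (r1) $A\subseteq E(\varepsilon)$ for all $\varepsilon\geq 0$; (r2) $0\leq\varepsilon_1\leq\varepsilon_2$ implies $E(\varepsilon_1)\subseteq E(\varepsilon_2)$; (r3) $E$ satisfies the transportation formula. $\mathbb{E}_c(A)=\{E\in\mathbb{E}(A):E\text{ is closed}\}$. A multifunction $E:\mathbb{R}_+\rightrightarrows B$ is additive if for all $\varepsilon_1,\varepsilon_2\geq 0$ and $b^1\in E(\varepsilon_1)$, $b^2\in E(\varepsilon_2)$ one has $q(b^1-b^2)\geq-(\varepsilon_1+\varepsilon_2)$. $\mathbb{E}_{ca}(A)=\{E\in\mathbb{E}_c(A):E\text{ is additive}\}$. For $E:\mathbb{R}_+\rightrightarrows B$, define $\lambda_E:B\to\overline{\mathbb{R}}$, $\lambda_E(b)=\inf\{\varepsilon\geq 0:b\in E(\varepsilon)\}$ (with $\inf\emptyset=+\infty$), and $\Lambda_E:=\lambda_E+q$. For $f:B\to\overline{\mathbb{R}}$, $f^{@}(c)=\sup_{b\in B}\{\lfloor b,c\rfloor-f(b)\}$ for $c\in B$. The inequality between functions is pointwise on $B$. *)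

(* Defs.v *)
From HB Require Import structures.
From mathcomp Require Import all_boot all_order all_algebra sesquilinear.
From mathcomp Require Import all_classical all_reals all_analysis.

Set Implicit Arguments.
Unset Strict Implicit.
Unset Printing Implicit Defensive.

Import Order.TTheory GRing.Theory Num.Theory.
Import numFieldNormedType.Exports.

Local Open Scope classical_set_scope.
Local Open Scope ring_scope.

Section NormDual.
Context {R : realType} {B : normedModType R}.

Definition in_dual (phi : B -> R^o) : Prop := linear phi /\ continuous phi.

(* The supremum is taken in R, so it is meaningful only for bounded phi; it is
   the norm of the dual space B^* on functionals satisfying in_dual. *)
Definition dual_norm (phi : B -> R^o) : R :=
  sup [set `|phi b| | b in [set b : B | `|b| <= 1]].

(* Continuity of a map from B, with its norm, to B^*, with the dual norm. *)
Definition dual_continuous (iota : B -> (B -> R^o)) : Prop :=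
  forall c0 : B, dual_norm (iota c - iota c0) @[c --> c0] --> (0 : R).

End NormDual.

Section SSD.
Context {R : realType} {B : completeNormedModType R}.
Variable form : {symmetric B}.

Definition q (b : B) : R := 2^-1 * form b b.

Definition Banach_SSD : Prop :=
  [/\ exists b : B, b != 0,
      forall b : B, 0 <= 2^-1 * `|b| ^+ 2 + q b
    & exists iota : B -> (B -> R^o),
        [/\ forall c, in_dual (iota c),
            linear iota,
            dual_continuous iota
          & forall b c, iota c b = form b c]].

Definition q_positive (A : set B) : Prop :=
  A !=set0 /\ forall b c, A b -> A c -> 0 <= q (b - c).

Definition maximally_q_positive (A : set B) : Prop :=
  q_positive A /\ forall A' : set B, q_positive A' -> A `<=` A' -> A' = A.

Implicit Types (A : set B) (E : {nonneg R} -> set B).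

Definition transportation_formula E : Prop :=
  forall (e1 e2 : {nonneg R}) (b1 b2 : B), E e1 b1 -> E e2 b2 ->
  forall a1 a2 : R, 0 <= a1 -> 0 <= a2 -> a1 + a2 = 1 ->
  exists e_ge0 :
      0 <= a1 * e1%:num + a2 * e2%:num + a1 * a2 * q (b1 - b2),
    E (NngNum e_ge0) (a1 *: b1 + a2 *: b2).

Definition EE A : set ({nonneg R} -> set B) :=
  [set E | [/\ forall e, A `<=` E e,
               forall e1 e2 : {nonneg R}, e1%:num <= e2%:num -> E e1 `<=` E e2
             & transportation_formula E]].

Definition graph E : set (R * B) :=
  [set p | exists2 e : {nonneg R}, e%:num = p.1 & E e p.2].

(* The graph is embedded in R * B; as the nonnegative reals are closed in R,
   being closed there is the same as being closed in the product of the
   nonnegative reals with B. *)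
Definition closed_multifun E : Prop := closed (graph E).

Definition additive_multifun E : Prop :=
  forall (e1 e2 : {nonneg R}) (b1 b2 : B), E e1 b1 -> E e2 b2 ->
  - (e1%:num + e2%:num) <= q (b1 - b2).

Definition EEc A : set ({nonneg R} -> set B) :=
  [set E | EE A E /\ closed_multifun E].

Definition EEca A : set ({nonneg R} -> set B) :=
  [set E | EEc A E /\ additive_multifun E].

Local Open Scope ereal_scope.

Definition lambda E (b : B) : \bar R :=
  ereal_inf [set (e%:num)%:E | e in [set e : {nonneg R} | E e b]].

Definition Lambda E (b : B) : \bar R := lambda E b + (q b)%:E.

Definition at_conj (f : B -> \bar R) (c : B) : \bar R :=
  ereal_sup [set (form b c)%:E - f b | b in [set: B]].

End SSD.

(* Main.v *)
Require Import Defs.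
From HB Require Import structures.
From mathcomp Require Import all_boot all_order all_algebra sesquilinear.
From mathcomp Require Import all_classical all_reals all_analysis.
From mathcomp Require Import ring lra.
Import Order.TTheory GRing.Theory Num.Theory.
Import numFieldNormedType.Exports.
Local Open Scope classical_set_scope.
Local Open Scope ring_scope.

(** Both sides of the equivalence are the same inequality,
      [- q (b - c) <= lambda E b + lambda E c]  for all [b] and [c].
    Additivity says that [- q (b - c)] is a lower bound of the sums [e1 + e2]
    with [E e1 b] and [E e2 c], and the greatest lower bound of these sums is
    [lambda E b + lambda E c] ([additive_multifunP]). On the other side,
    [at_conj form (Lambda form E) c <= Lambda form E c] means
    [form b c - (lambda E b + q b) <= lambda E c + q c] for all [b], and
    expanding [q (b - c) = q b + q c - form b c] gives the same inequality
    ([at_conj_le_LambdaP]). As [lambda E] has only nonnegative values, the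
    only infinite value to be considered is [+oo], for which every inequality
    above is trivial. *)

Section AdditiveMultifun.
Context {R : realType} {B : completeNormedModType R}.
Variable form : {symmetric B}.
Implicit Types (E : {nonneg R} -> set B) (b c : B).

Lemma qB b c : q form (b - c) = q form b + q form c - form b c.
Proof.
have formC : form c b = form b c by rewrite (hermC form c b) expr0 mul1r.
have formBr x y z : form x (y - z) = form x y - form x z.
  exact: (linearBr form).
have formBl x y z : form (x - y) z = form x z - form y z.
  exact: (linearBl form).
rewrite /q formBl !formBr formC.
by field.
Qed.

Lemma lambda_ge0 E b : (0 <= lambda E b)%E.
Proof. by apply/ereal_infP => _ [e _ <-]; rewrite lee_fin. Qed.

Lemma lambda_le E (e : {nonneg R}) b : E e b -> (lambda E b <= e%:num%:E)%E.
Proof. by move=> Eb; apply: ge_ereal_inf; exists e%:num%:E => //; exists e. Qed.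

(** The pairs [(e1, e2)] with [E e1 b] and [E e2 c] form a product set, so the
    infimum of [e1 + e2] splits into the sum of two infima. *)
Lemma additive_multifunP E :
  additive_multifun form E <->
  forall b c, ((- q form (b - c))%:E <= lambda E b + lambda E c)%E.
Proof.
split=> [addE b c|leE e1 e2 b c Eb Ec]; last first.
  have : ((- q form (b - c))%:E <= e1%:num%:E + e2%:num%:E)%E.
    by apply: le_trans (leE b c) _; apply: leeD; apply: lambda_le.
  by rewrite -EFinD lee_fin => ?; lra.
(* The infima are introduced one at a time, [e] being fixed in the first. *)
have leEb (e : {nonneg R}) : E e c ->
    ((- q form (b - c))%:E <= lambda E b + e%:num%:E)%E.
  move=> Ec; rewrite -leeBlDr //; apply/ereal_infP => _ [e1 Eb <-].
  by have := addE _ _ _ _ Eb Ec; rewrite -EFinB lee_fin => ?; lra.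
case lb: (lambda E b) (lambda_ge0 E b) leEb => [r| |] // _ leEb.
  rewrite -leeBlDl //; apply/ereal_infP => _ [e Ec <-].
  by rewrite leeBlDl // leEb.
by rewrite addye ?leey // gt_eqF // (lt_le_trans _ (lambda_ge0 E c)) ?ltNy0.
Qed.

(** The expansion [qB] turns the Fenchel inequality
    [form b c <= Lambda form E b + Lambda form E c] into a bound on
    [lambda E b + lambda E c]. *)
Lemma at_conj_le_LambdaP E :
  (forall c, (at_conj form (Lambda form E) c <= Lambda form E c)%E) <->
  forall b c, ((- q form (b - c))%:E <= lambda E b + lambda E c)%E.
Proof.
have FenchelE b c :
    ((form b c)%:E - Lambda form E b <= Lambda form E c)%E =
    ((- q form (b - c))%:E <= lambda E b + lambda E c)%E.
  rewrite /Lambda qB.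
  case: (lambda E b) (lambda_ge0 E b) => [r| |] // _;
    case: (lambda E c) (lambda_ge0 E c) => [s| |] // _ /=.
  by rewrite -!EFinD !lee_fin; apply/idP/idP => ?; lra.
  1-3: by rewrite ?addye ?addey ?leey ?leNye.
split=> [leL b c|leE c].
  rewrite -FenchelE; move/ereal_supP: (leL c); apply.
  by exists b.
by apply/ereal_supP => _ [b _ <-]; rewrite FenchelE.
Qed.

End AdditiveMultifun.

Theorem theorem20 (R : realType) (B : completeNormedModType R)
    (form : {symmetric B}) (A : set B) (E : {nonneg R} -> set B) :
  Banach_SSD form -> maximally_q_positive form A -> EEc form A E ->
  (EEca form A E <->
   forall b : B, (at_conj form (Lambda form E) b <= Lambda form E b)%E).
Proof.
move=> _ _ EcE; rewrite at_conj_le_LambdaP -additive_multifunP.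
by split=> [[]|].
Qed.
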